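(* Let $c\in\mathbb{C}$ and let $M$ be a nontrivial irreducible $\mathcal{CW}(0,c)$-module of rank one. (1) If $c=0$, then $M$ is isomorphic to $M_{h_i(\lambda)}$ for some nonzero family $\big(h_i(\lambda)\big)_{i\in\mathbb{Z}}\in\prod_{i\in\mathbb{Z}}\mathbb{C}[\lambda]$, where $M_{h_i(\lambda)}=\mathbb{C}[\partial]v$ is the free rank one $\mathbb{C}[\partial]$-module with $\lambda$-actions $L_i\,{}_\lambda\,v=h_i(\lambda)v$ for $i\in\mathbb{Z}$. (2) If $c\neq0$, then $M$ is isomorphic to $M_{\tau,\rho,\sigma}$ for some $\tau,\rho\in\mathbb{C}\setminus\{0\}$ and $\sigma\in\mathbb{C}$, where $M_{\tau,\rho,\sigma}=\mathbb{C}[\partial]v$ is the free rank one $\mathbb{C}[\partial]$-module with $\lambda$-actions $L_i\,{}_\lambda\,v=\tau^i(c\partial+\rho\lambda+\sigma)v$ for $i\in\mathbb{Z}$.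
   Context: A Lie conformal algebra is a $\mathbb{C}[\partial]$-module $R$ with a linear map $R\otimes R\to R[\lambda]$, $x\otimes y\mapsto[x\,{}_\lambda\,y]$, such that for all $x,y,z\in R$: $[\partial x\,{}_\lambda\,y]=-\lambda[x\,{}_\lambda\,y]$, $[x\,{}_\lambda\,\partial y]=(\partial+\lambda)[x\,{}_\lambda\,y]$, $[x\,{}_\lambda\,y]=-[y\,{}_{-\lambda-\partial}\,x]$, and $[x\,{}_\lambda\,[y\,{}_\mu\,z]]=[[x\,{}_\lambda\,y]\,{}_{\lambda+\mu}\,z]+[y\,{}_\mu\,[x\,{}_\lambda\,z]]$. For $c\in\mathbb{C}$, $\mathcal{CW}(0,c)$ is the Lie conformal algebra that is free as a $\mathbb{C}[\partial]$-module with basis $\{L_i\mid i\in\mathbb{Z}\}$ and has $\lambda$-brackets $[L_i\,{}_\lambda\,L_j]=c(\partial+2\lambda)L_{i+j}$ for $i,j\in\mathbb{Z}$. A (conformal) module over a Lie conformal algebra $R$ is a $\mathbb{C}[\partial]$-module $V$ with a $\lambda$-action, i.e. a linear map $R\otimes V\to V[\lambda]$, $x\otimes v\mapsto x\,{}_\lambda\,v$, such that for all $x,y\in R$, $v\in V$: $(\partial x)\,{}_\lambda\,v=-\lambda\,x\,{}_\lambda\,v$, $x\,{}_\lambda\,(\partial v)=(\partial+\lambda)\,x\,{}_\lambda\,v$, and $x\,{}_\lambda\,(y\,{}_\mu\,v)-y\,{}_\mu\,(x\,{}_\lambda\,v)=[x\,{}_\lambda\,y]\,{}_{\lambda+\mu}\,v$.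 It is of rank $n$ if $V$ is a free $\mathbb{C}[\partial]$-module of rank $n$. A module is nontrivial if its $\lambda$-action is not identically zero. A submodule is a $\mathbb{C}[\partial]$-submodule $W\subseteq V$ with $R\,{}_\lambda\,W\subseteq W[\lambda]$; a nonzero module is irreducible if its only submodules are $0$ and itself. An isomorphism of modules is a $\mathbb{C}[\partial]$-linear bijection commuting with the $\lambda$-actions. *)

(* Defs.v *)
From HB Require Import structures.
From mathcomp Require Import all_boot all_order all_algebra.
From mathcomp Require Import finmap monalg ring.

Set Implicit Arguments.
Unset Strict Implicit.
Unset Printing Implicit Defensive.

Import GRing.Theory.
Local Open Scope ring_scope.

(* V[lambda] as the finitely supported families of coefficients in V.  It is a
   copy of {malg V[nat]} because, for V an A-module, it carries the structure of
   an A[lambda]-module, whereas {malg A[nat]} is already an A-module.  Iterating,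
   V[lambda][mu] = lpoly (lpoly V) is an A[lambda][mu]-module. *)
Definition lpoly (V : zmodType) := {malg V[nat]}.

HB.instance Definition _ (V : zmodType) :=
  GRing.Zmodule.copy (lpoly V) {malg V[nat]}.

Section LPolyModule.
Variables (A : nzRingType) (V : lmodType A).
Implicit Types (p q : {poly A}) (g h : lpoly V).

Definition lpoly_scale p g : lpoly V :=
  \sum_(i < size p) \sum_(k <- msupp g) << p`_i *: g@_k *g (i + k)%N >>.

Lemma coef_lpoly_scale p g n :
  (lpoly_scale p g)@_n = \sum_(i < n.+1) p`_i *: g@_(n - i)%N.
Proof.
rewrite /lpoly_scale raddf_sum /=.
pose F i := if (i <= n)%N then p`_i *: g@_(n - i)%N else 0.
transitivity (\sum_(i < size p) F i).
  apply: eq_bigr => i _; rewrite raddf_sum /F /=.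
  have [le_in|lt_ni] := leqP i n; last first.
    rewrite big1 // => k _; rewrite mcoeffU; case: eqP => // eq_n.
    by move: lt_ni; rewrite -eq_n ltnNge leq_addr.
  have [n_in|n_out] := boolP ((n - i)%N \in msupp g).
    rewrite (big_fsetD1 (n - i)%N) //= mcoeffU subnKC // eqxx mulr1n.
    rewrite big1_fset ?addr0 // => k; rewrite in_fsetD1 => /andP[k_neq _] _.
    rewrite mcoeffU; case: eqP => // eq_n.
    by rewrite -eq_n addKn eqxx in k_neq.
  rewrite (mcoeff_outdom n_out) scaler0 big1_fset // => k k_in _.
  rewrite mcoeffU; case: eqP => // eq_n.
  by rewrite -eq_n addKn k_in in n_out.
transitivity (\sum_(i < n.+1) F i); last first.
  by apply: eq_bigr => i _; rewrite /F -ltnS ltn_ord.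
rewrite (big_ord_widen (maxn (size p) n.+1) F) ?leq_maxl //.
rewrite (big_ord_widen (maxn (size p) n.+1) F) ?leq_maxr //.
rewrite big_mkcond [RHS]big_mkcond; apply: eq_bigr => i _ /=.
rewrite /F ltnS; case: ltnP => // le_pi; case: leqP => // _.
by rewrite nth_default ?scale0r.
Qed.

Lemma coef_lpoly_scale_rev p g n :
  (lpoly_scale p g)@_n = \sum_(i < n.+1) p`_(n - i)%N *: g@_(i : nat).
Proof.
rewrite coef_lpoly_scale (reindex_inj rev_ord_inj) /=.
by apply: eq_bigr => j _; rewrite (sub_ordK j).
Qed.

Fact lpoly_scaleA p q g :
  lpoly_scale p (lpoly_scale q g) = lpoly_scale (p * q) g.
Proof.
apply/malgP => n; rewrite coef_lpoly_scale coef_lpoly_scale_rev.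
pose coef3 (j i : nat) := p`_j *: (q`_(n - j - i)%N *: g@_(i : nat)).
transitivity (\sum_(j < n.+1) \sum_(i < n.+1 | (i <= n - j)%N) coef3 j i).
  apply: eq_bigr => /= j _; rewrite coef_lpoly_scale_rev scaler_sumr.
  by rewrite (big_ord_narrow_leq (leq_subr _ _)).
rewrite (exchange_big_dep predT) //=; apply: eq_bigr => i _.
transitivity (\sum_(j < n.+1 | (j <= n - i)%N) coef3 j i).
  apply: eq_bigl => j; rewrite -ltnS -(ltnS j) -!subSn ?leq_ord //.
  by rewrite -subn_gt0 -(subn_gt0 j) -!subnDA addnC.
rewrite (big_ord_narrow_leq (leq_subr _ _)) coefM scaler_suml.
by apply: eq_bigr => j _; rewrite /coef3 scalerA -!subnDA addnC.
Qed.

Fact lpoly_scale1 : left_id 1 lpoly_scale.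
Proof.
move=> g; apply/malgP => n; rewrite coef_lpoly_scale big_ord_recl subn0.
rewrite coef1 scale1r big1 ?addr0 // => i _.
by rewrite coef1 scale0r.
Qed.

Fact lpoly_scaleDr : right_distributive lpoly_scale +%R.
Proof.
move=> p g h; apply/malgP => n; rewrite mcoeffD !coef_lpoly_scale -big_split.
by apply: eq_bigr => i _; rewrite mcoeffD scalerDr.
Qed.

Fact lpoly_scaleDl g : {morph lpoly_scale^~ g : p q / p + q}.
Proof.
move=> p q; apply/malgP => n; rewrite mcoeffD !coef_lpoly_scale -big_split.
by apply: eq_bigr => i _; rewrite coefD scalerDl.
Qed.

HB.instance Definition _ := GRing.Zmodule_isLmodule.Build {poly A} (lpoly V)
  lpoly_scaleA lpoly_scale1 lpoly_scaleDr lpoly_scaleDl.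

Lemma coef_lpolyZ p g n :
  (p *: g)@_n = \sum_(i < n.+1) p`_i *: g@_(n - i)%N.
Proof. exact: coef_lpoly_scale. Qed.

Lemma lpolyZC a g n : (a%:P *: g)@_n = a *: g@_n.
Proof.
rewrite coef_lpolyZ big_ord_recl subn0 coefC big1 ?addr0 // => i _.
by rewrite coefC scale0r.
Qed.

Lemma lpolyZXU v k : ('X : {poly A}) *: (<< v *g k >> : lpoly V) = << v *g k.+1 >>.
Proof.
apply/malgP => -[|n]; rewrite coef_lpolyZ big_ord_recl coefX scale0r add0r.
  by rewrite big_ord0 mcoeffU.
rewrite big_ord_recl coefX scale1r big1 => [|i _]; last first.
  by rewrite coefX scale0r.
by rewrite addr0 !mcoeffU /bump /= subSS subn0 eqSS.
Qed.

End LPolyModule.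

Definition lconst (V : zmodType) (v : V) : lpoly V := << v *g 0%N >>.

(* \sum_k s^k phi(g_k), for g = \sum_k lambda^k g_k: apply phi to the
   coefficients of g and substitute s for lambda, powers of s acting from the
   left. *)
Definition lsubst (U : zmodType) (B : nzRingType) (W : lmodType B)
    (phi : U -> W) (g : lpoly U) (s : B) : W :=
  \sum_(k <- msupp g) s ^+ k *: phi g@_k.

Section Conformal.
Variable K : fieldType.

(* K plays the role of the complex numbers C, and d that of the generator of
   C[d].  The indeterminates of C[d][lambda] and C[d][lambda][mu]. *)
Definition d1 : {poly {poly K}} := 'X%:P.
Definition lam1 : {poly {poly K}} := 'X.
Definition d2 : {poly {poly {poly K}}} := 'X%:P%:P.
Definition lam2 : {poly {poly {poly K}}} := 'X%:P.
Definition mu2 : {poly {poly {poly K}}} := 'X.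

Implicit Types R V : lmodType {poly K}.

Definition lambda_map R V := R -> V -> lpoly V.

Section LambdaMap.
Variables R V : lmodType {poly K}.
Variable act : lambda_map R V.

Definition bilinear_lambda :=
  (forall (a : K) x y v,
     act (a%:P *: x + y) v = a%:P%:P *: act x v + act y v) /\
  (forall (a : K) x v w,
     act x (a%:P *: v + w) = a%:P%:P *: act x v + act x w).

Definition sesquilinear_lambda :=
  (forall x v, act ('X *: x) v = - (lam1 *: act x v)) /\
  (forall x v, act x ('X *: v) = (d1 + lam1) *: act x v).

(* x_s v, in V[lambda][mu]. *)
Definition act_at (s : {poly {poly {poly K}}}) (x : R) (v : V) :
    lpoly (lpoly V) :=
  lsubst (fun w => lconst (lconst w)) (act x v) s.

(* x_s (y_t v), in V[lambda][mu]. *)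
Definition act_act s x t y v : lpoly (lpoly V) :=
  lsubst (act_at s x) (act y v) t.

(* [x_lambda y]_(lambda + mu) v, in V[lambda][mu]. *)
Definition bracket_act (br : lambda_map R R) x y v : lpoly (lpoly V) :=
  lsubst (fun r => act_at (lam2 + mu2) r v) (br x y) lam2.

End LambdaMap.

Definition lie_conformal_axioms R (br : lambda_map R R) :=
  [/\ bilinear_lambda br,
      sesquilinear_lambda br,
      forall x y, br x y = - lsubst (@lconst R) (br y x) (- lam1 - d1) &
      forall x y z, act_act br lam2 x mu2 y z =
        bracket_act br br x y z + act_act br mu2 y lam2 x z].

Record lieConformalAlgebra := LieConformalAlgebra {
  lca_sort :> lmodType {poly K};
  lca_bracket : lambda_map lca_sort lca_sort;
  lca_axioms : lie_conformal_axioms lca_bracket }.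

Definition conformal_module_axioms (R : lieConformalAlgebra) V
    (act : lambda_map R V) :=
  [/\ bilinear_lambda act,
      sesquilinear_lambda act &
      forall x y v, act_act act lam2 x mu2 y v - act_act act mu2 y lam2 x v =
        bracket_act act (@lca_bracket R) x y v].

Record conformalModule (R : lieConformalAlgebra) := ConformalModule {
  cm_sort :> lmodType {poly K};
  cm_act : lambda_map R cm_sort;
  cm_axioms : conformal_module_axioms cm_act }.

Section Modules.
Variable R : lieConformalAlgebra.
Implicit Types M N : conformalModule R.

(* M is free of rank n over C[d]. *)
Definition has_rank M n :=
  exists f : {linear M -> 'rV[{poly K}]_n}, bijective f.

Definition nontrivial M := exists x v, cm_act (c := M) x v <> 0.

Definition submodule M (W : M -> Prop) :=
  [/\ W 0,
      forall (p : {poly K}) u v, W u -> W v -> W (p *: u + v) &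
      forall x v n, W v -> W (cm_act x v)@_n].

Definition irreducible M :=
  (exists v : M, v <> 0) /\
  (forall W : M -> Prop, submodule W ->
     (forall v, W v <-> v = 0) \/ (forall v, W v)).

Definition isomorphic M N :=
  exists f : {linear M -> N}, bijective f /\
    forall x v n, (cm_act x (f v))@_n = f (cm_act x v)@_n.

End Modules.

(* p(-lambda) q(d + lambda), the factor which sesquilinearity forces in front of
   the lambda-action of p(d)x on q(d)v. *)
Definition sesq (p q : {poly K}) : {poly {poly K}} :=
  (p^:P \Po (- lam1)) * (q^:P \Po (d1 + lam1)).

(* The free C[d]-module with basis (L_i), i in Z. *)
Definition CW_carrier : lmodType {poly K} := {malg {poly K}[int]}.

Definition CW_L (i : int) : CW_carrier := << 1 *g i >>.

Definition CW_bracket (c : K) (x y : CW_carrier) : lpoly CW_carrier :=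
  \sum_(i <- msupp x) \sum_(j <- msupp y)
    (sesq x@_i y@_j * (c%:P%:P * (d1 + lam1 *+ 2))) *: lconst (CW_L (i + j)).

(* The action on the free module C[d]v, v = 1, with L_i_lambda v = f_i v. *)
Definition rank1_act (f : int -> {poly {poly K}}) (x : CW_carrier)
    (q : {poly K}^o) : lpoly {poly K}^o :=
  \sum_(i <- msupp x) (sesq x@_i q * f i) *: lconst (1 : {poly K}^o).

End Conformal.

Lemma morph0D (U W : zmodType) (phi : U -> W) :
  {morph phi : u v / u + v} -> phi 0 = 0.
Proof. by move=> phiD; apply: (@addrI _ (phi 0)); rewrite -phiD !addr0. Qed.

Lemma malg_ind (J : choiceType) (G : zmodType) (P : {malg G[J]} -> Prop) :
  P 0 -> (forall g h, P g -> P h -> P (g + h)) -> (forall k u, P << u *g k >>) ->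
  forall g, P g.
Proof. by move=> P0 PD PU g; rewrite [g]monalgE; apply: big_ind. Qed.

Section MalgSum.
Variables (J : choiceType) (G W : zmodType) (F : J -> G -> W).
Hypothesis FD : forall j, {morph F j : u v / u + v}.

Lemma msum_w (d : {fset J}) (g : {malg G[J]}) : (msupp g `<=` d)%fset ->
  \sum_(k <- msupp g) F k g@_k = \sum_(k <- d) F k g@_k.
Proof.
move=> gd; apply: big_fset_incl => // k _ k_out.
by rewrite (mcoeff_outdom k_out) (morph0D (FD k)).
Qed.

Lemma msumD (g h : {malg G[J]}) :
  \sum_(k <- msupp (g + h)) F k (g + h)@_k =
  \sum_(k <- msupp g) F k g@_k + \sum_(k <- msupp h) F k h@_k.
Proof.
pose d := (msupp g `|` msupp h)%fset.
rewrite (@msum_w d) ?msuppD_le // (@msum_w d g) ?fsubsetUl //.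
rewrite (@msum_w d h) ?fsubsetUr // -big_split; apply: eq_bigr => k _.
by rewrite mcoeffD FD.
Qed.

Lemma msum0 : \sum_(k <- msupp (0 : {malg G[J]})) F k (0 : {malg G[J]})@_k = 0.
Proof. by rewrite msupp0 big_seq_fset0. Qed.

Lemma msumU k u : \sum_(j <- msupp << u *g k >>) F j << u *g k >>@_j = F k u.
Proof. by rewrite (msum_w msuppU_le) big_seq_fset1 mcoeffUU. Qed.

End MalgSum.

Section LsubstTheory.
Variables (U : zmodType) (B : comNzRingType) (W : lmodType B) (phi : U -> W).
Hypothesis phiD : {morph phi : u v / u + v}.
Variable s : B.

Let FD (k : nat) : {morph (fun u => s ^+ k *: phi u) : u v / u + v}.
Proof. by move=> u v; rewrite phiD scalerDr. Qed.

Lemma lsubstD : {morph (fun g : lpoly U => lsubst phi g s) : g h / g + h}.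
Proof. by move=> g h; apply: (msumD FD). Qed.

Lemma lsubst0 : lsubst phi 0 s = 0.
Proof. by rewrite /lsubst msupp0 big_seq_fset0. Qed.

Lemma lsubstU u k : lsubst phi << u *g k >> s = s ^+ k *: phi u.
Proof. exact: (msumU FD). Qed.

Lemma lsubst_const u : lsubst phi (lconst u) s = phi u.
Proof. by rewrite lsubstU scale1r. Qed.

End LsubstTheory.

Lemma lsubst_add (U : zmodType) (B : comNzRingType) (W : lmodType B)
    (phi psi : U -> W) g s :
  lsubst (fun u => phi u + psi u) g s = lsubst phi g s + lsubst psi g s.
Proof.
by rewrite /lsubst -big_split; apply: eq_bigr => k _; rewrite scalerDr.
Qed.

Lemma lsubst_scale (U : zmodType) (B : comNzRingType) (W : lmodType B)
    (phi : U -> W) b g s :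
  lsubst (fun u => b *: phi u) g s = b *: lsubst phi g s.
Proof.
rewrite /lsubst scaler_sumr; apply: eq_bigr => k _.
by rewrite !scalerA mulrC.
Qed.

Lemma lsubstZ (A : nzRingType) (U : lmodType A) (B : comNzRingType)
    (W : lmodType B) (theta : {rmorphism A -> B}) (phi : U -> W) s p g :
  {morph phi : u v / u + v} -> (forall a u, phi (a *: u) = theta a *: phi u) ->
  lsubst phi (p *: g) s = (map_poly theta p).[s] *: lsubst phi g s.
Proof.
move=> phiD phiZ.
elim/poly_ind: p => [|p a IHp].
  by rewrite scale0r rmorph0 horner0 scale0r lsubst0.
rewrite scalerDl lsubstD // rmorphD rmorphM /= map_polyX map_polyC.
rewrite hornerMXaddC scalerDl; congr (_ + _); last first.
  elim/malg_ind: g {IHp} => [|g h IHg IHh|k u].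
  - by rewrite !scaler0 lsubst0 scaler0.
  - by rewrite scalerDr !lsubstD // IHg IHh scalerDr.
  have -> : a%:P *: (<< u *g k >> : lpoly U) = << a *: u *g k >>.
    by apply/malgP => n; rewrite lpolyZC !mcoeffU scalerMnr.
  by rewrite !lsubstU // phiZ !scalerA mulrC.
rewrite commr_polyX -[in LHS]scalerA mulrC -[RHS]scalerA -IHp; move: (p *: g) => {IHp}h.
elim/malg_ind: h => [|g1 h IHg IHh|k u].
- by rewrite !scaler0 lsubst0 scaler0.
- by rewrite scalerDr !lsubstD // IHg IHh scalerDr.
by rewrite lpolyZXU !lsubstU // scalerA exprS.
Qed.

Section Eval.
Variables (K : fieldType) (B : comNzRingType) (iota : {rmorphism K -> B}).

Definition ev1 (s : B) (p : {poly K}) : B := (map_poly iota p).[s].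

Let cev1 s : commr_rmorph iota s. Proof. by move=> a; apply: mulrC. Qed.
HB.instance Definition _ s :=
  GRing.RMorphism.copy (ev1 s) (horner_morph (cev1 s)).

Lemma ev1X s : ev1 s 'X = s. Proof. exact: (horner_morphX (cev1 s)). Qed.
Lemma ev1C s a : ev1 s a%:P = iota a. Proof. exact: (horner_morphC (cev1 s)). Qed.

Definition ev2 (s t : B) (P : {poly {poly K}}) : B := (map_poly (ev1 s) P).[t].

Let cev2 s t : commr_rmorph (ev1 s) t. Proof. by move=> a; apply: mulrC. Qed.
HB.instance Definition _ s t :=
  GRing.RMorphism.copy (ev2 s t) (horner_morph (cev2 s t)).

Lemma ev2X s t : ev2 s t 'X = t. Proof. exact: (horner_morphX (cev2 s t)). Qed.
Lemma ev2C s t p : ev2 s t p%:P = ev1 s p.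
Proof. exact: (horner_morphC (cev2 s t)). Qed.

Lemma ev2N s t P : ev2 s t (- P) = - ev2 s t P.
Proof. exact: rmorphN. Qed.

Lemma ev2D s t P Q : ev2 s t (P + Q) = ev2 s t P + ev2 s t Q.
Proof. exact: rmorphD. Qed.

Lemma ev2M s t P Q : ev2 s t (P * Q) = ev2 s t P * ev2 s t Q.
Proof. exact: rmorphM. Qed.

Lemma ev2Mn s t P n : ev2 s t (P *+ n) = ev2 s t P *+ n.
Proof. exact: rmorphMn. Qed.

Lemma ev2_comp s t p (q : {poly {poly K}}) :
  ev2 s t (p^:P \Po q) = ev1 (ev2 s t q) p.
Proof.
elim/poly_ind: p => [|p a IHp]; first by rewrite rmorph0 comp_poly0 !rmorph0.
rewrite rmorphD rmorphM /= map_polyX map_polyC comp_polyD comp_polyM.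
rewrite comp_polyX comp_polyC !rmorphD !rmorphM /= IHp ev2C !ev1C ev1X.
by [].
Qed.

Lemma ev2_lift s t (h : {poly K}) : ev2 s t h^:P = ev1 t h.
Proof. by rewrite -[h^:P]comp_polyXr ev2_comp ev2X. Qed.

Lemma ev2_sesq s t p q : ev2 s t (sesq p q) = ev1 (- t) p * ev1 (s + t) q.
Proof.
by rewrite /sesq ev2M !ev2_comp ev2N ev2D ev2X ev2C ev1X.
Qed.

Lemma ev2_sesqM s t p q P :
  ev2 s t (sesq p q * P) = ev1 (- t) p * ev1 (s + t) q * ev2 s t P.
Proof. by rewrite ev2M ev2_sesq. Qed.

Lemma ev2_vir s t c : ev2 s t (c%:P%:P * (d1 K + lam1 K *+ 2)) =
  iota c * (s + t *+ 2).
Proof. by rewrite ev2M ev2D ev2Mn !ev2C ev2X ev1C ev1X. Qed.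

End Eval.

Section Sesq.
Variables (K : fieldType) (R V : lmodType {poly K}) (act : lambda_map R V).
Hypotheses (bil : bilinear_lambda act) (ses : sesquilinear_lambda act).

Lemma actDl v : {morph act^~ v : x y / x + y}.
Proof. by move=> x y; rewrite -[x]scale1r bil.1 !scale1r. Qed.

Lemma actDr x : {morph act x : v w / v + w}.
Proof. by move=> v w; rewrite -[v]scale1r bil.2 !scale1r. Qed.

Lemma actZl p x v : act (p *: x) v = (p^:P \Po (- lam1 K)) *: act x v.
Proof.
have actKl (a : K) y : act (a%:P *: y) v = a%:P%:P *: act y v.
  by rewrite -[_ *: y]addr0 bil.1 (morph0D (actDl v)) addr0.
elim/poly_ind: p x => [|p a IHp] x.
  by rewrite rmorph0 comp_poly0 !scale0r (morph0D (actDl v)).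
rewrite scalerDl actDl actKl -scalerA IHp ses.1 rmorphD rmorphM /= map_polyX.
rewrite map_polyC /= comp_polyD comp_polyM comp_polyX comp_polyC.
by rewrite [RHS]scalerDl -[in RHS]scalerA scaleNr.
Qed.

Lemma actZr p x v : act x (p *: v) = (p^:P \Po (d1 K + lam1 K)) *: act x v.
Proof.
have actKr (a : K) w : act x (a%:P *: w) = a%:P%:P *: act x w.
  by rewrite -[_ *: w]addr0 bil.2 (morph0D (actDr x)) addr0.
elim/poly_ind: p v => [|p a IHp] v.
  by rewrite rmorph0 comp_poly0 !scale0r (morph0D (actDr x)).
rewrite scalerDl actDr actKr -scalerA IHp ses.2 rmorphD rmorphM /= map_polyX.
rewrite map_polyC /= comp_polyD comp_polyM comp_polyX comp_polyC.
by rewrite [RHS]scalerDl -[in RHS]scalerA.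
Qed.

Definition pol3C : {rmorphism K -> {poly {poly {poly K}}}} :=
  polyC \o (polyC \o (polyC : K -> {poly K})).
Local Notation cc w := (lconst (lconst w)).
Local Notation D := (d2 K).
Local Notation ev1' := (ev1 pol3C).
Local Notation ev2' := (ev2 pol3C).

Lemma ev1_d2 p : ev1' D p = p%:P%:P.
Proof.
elim/poly_ind: p => [|p a IHp]; first by rewrite !rmorph0.
by rewrite rmorphD rmorphM /= ev1X ev1C IHp !polyCD !polyCM.
Qed.

Lemma ccD : {morph (fun w : V => cc w) : u v / u + v}.
Proof. by move=> u v; rewrite /lconst !monalgUD. Qed.

Lemma ccZ p (w : V) : cc (p *: w) = ev1' D p *: cc w.
Proof.
apply/malgP => n; rewrite ev1_d2 lpolyZC; apply/malgP => m.
by rewrite lpolyZC /lconst !mcoeffU; case: eqP; rewrite ?mulr1n ?mulr0n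
  ?mcoeffU ?mcoeff0 ?scaler0 //; case: eqP; rewrite ?scaler0.
Qed.

Lemma act_atDr s x : {morph act_at act s x : v w / v + w}.
Proof. by move=> v w; rewrite /act_at actDr lsubstD //; apply: ccD. Qed.

Lemma act_atDl s v : {morph act_at act s ^~ v : x y / x + y}.
Proof. by move=> x y; rewrite /act_at actDl lsubstD //; apply: ccD. Qed.

Lemma act_atE s x v (P : {poly {poly K}}) (g : lpoly V) :
  act x v = P *: g ->
  act_at act s x v = ev2' D s P *: lsubst (fun w => cc w) g s.
Proof.
by move=> eq_act; rewrite /act_at eq_act (lsubstZ _ _ _ ccD ccZ).
Qed.

Lemma act_atZr s p x v : act_at act s x (p *: v) = ev1' (D + s) p *: act_at act s x v.
Proof.
have eD : ev2' D s (d1 K + lam1 K) = D + s.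
  by rewrite ev2D ev2X ev2C ev1X.
by rewrite (act_atE s (actZr p x v)) ev2_comp eD.
Qed.

Lemma act_atZl s p x v : act_at act s (p *: x) v = ev1' (- s) p *: act_at act s x v.
Proof.
have eN : ev2' D s (- lam1 K) = - s by rewrite ev2N ev2X.
by rewrite (act_atE s (actZl p x v)) ev2_comp eN.
Qed.

(* Actions on generators determine the iterated actions. *)
Lemma act_actE s t x y v w u (P Q : {poly {poly K}}) :
  act y v = P *: lconst w -> act x w = Q *: lconst u ->
  act_act act s x t y v = (ev2' (D + s) t P * ev2' D s Q) *: cc u.
Proof.
move=> eq_y eq_x; rewrite /act_act eq_y.
rewrite (lsubstZ _ _ _ (act_atDr s x) (fun p => act_atZr s p x)).
rewrite lsubst_const; last exact: act_atDr.
by rewrite (act_atE s eq_x) lsubst_const ?scalerA //; apply: ccD.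
Qed.

Lemma bracket_actE (br : lambda_map R R) x y z v u (P Q : {poly {poly K}}) :
  br x y = P *: lconst z -> act z v = Q *: lconst u ->
  bracket_act act br x y v =
  (ev2' (- (lam2 K + mu2 K)) (lam2 K) P * ev2' D (lam2 K + mu2 K) Q) *: cc u.
Proof.
move=> eq_br eq_z; rewrite /bracket_act eq_br.
rewrite (lsubstZ _ _ _ (act_atDl _ v) (fun p r => act_atZl _ p r v)).
rewrite lsubst_const; last exact: act_atDl.
by rewrite (act_atE _ eq_z) lsubst_const ?scalerA //; apply: ccD.
Qed.

Lemma act_actDv s t x y : {morph act_act act s x t y : v w / v + w}.
Proof. by move=> v w; rewrite /act_act actDr lsubstD //; apply: act_atDr. Qed.

Lemma act_actDy s t x v : {morph (fun y => act_act act s x t y v) : y z / y + z}.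
Proof. by move=> y z; rewrite /act_act actDl lsubstD //; apply: act_atDr. Qed.

Lemma act_actDx s t y v : {morph (fun x => act_act act s x t y v) : x z / x + z}.
Proof.
move=> x z; rewrite /act_act -lsubst_add /lsubst; apply: eq_bigr => k _.
by rewrite act_atDl.
Qed.

Lemma bracket_actDv br x y : {morph bracket_act act br x y : v w / v + w}.
Proof.
move=> v w; rewrite /bracket_act -lsubst_add /lsubst; apply: eq_bigr => k _.
by rewrite act_atDr.
Qed.

End Sesq.

Section SesqBr.
Variables (K : fieldType) (R V : lmodType {poly K}) (act : lambda_map R V).
Variable (br : lambda_map R R).
Hypotheses (bil : bilinear_lambda act) (bilb : bilinear_lambda br).

Lemma bracket_actDy x v : {morph (fun y => bracket_act act br x y v) : y z / y + z}.
Proof.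
by move=> y z; rewrite /bracket_act actDr // lsubstD //; apply: act_atDl.
Qed.

Lemma bracket_actDx y v : {morph (fun x => bracket_act act br x y v) : x z / x + z}.
Proof.
by move=> x z; rewrite /bracket_act actDl // lsubstD //; apply: act_atDl.
Qed.

End SesqBr.

Section SesqExt.
Variable K : fieldType.

Lemma sesqDl q : {morph (@sesq K)^~ q : p r / p + r}.
Proof. by move=> p r; rewrite /sesq rmorphD comp_polyD mulrDl. Qed.

Lemma sesqDr p : {morph (@sesq K) p : q r / q + r}.
Proof. by move=> q r; rewrite /sesq rmorphD comp_polyD mulrDr. Qed.

Lemma sesqZl r p q : sesq (r * p) q = (r^:P \Po (- lam1 K)) * sesq p q.
Proof. by rewrite /sesq rmorphM comp_polyM mulrA. Qed.

Lemma sesqZr r p q : sesq p (r * q) = (r^:P \Po (d1 K + lam1 K)) * sesq p q.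
Proof. by rewrite /sesq rmorphM comp_polyM mulrCA. Qed.

Lemma sesq11 : sesq (1 : {poly K}) 1 = 1.
Proof. by rewrite /sesq rmorph1 !comp_polyC mul1r. Qed.

Lemma sesq_axioms (R V : lmodType {poly K}) (act : lambda_map R V) :
  (forall v, {morph act^~ v : x y / x + y}) ->
  (forall x, {morph act x : v w / v + w}) ->
  (forall p x v, act (p *: x) v = (p^:P \Po (- lam1 K)) *: act x v) ->
  (forall p x v, act x (p *: v) = (p^:P \Po (d1 K + lam1 K)) *: act x v) ->
  bilinear_lambda act /\ sesquilinear_lambda act.
Proof.
move=> aDl aDr aZl aZr; split; split.
- by move=> a x y v; rewrite aDl aZl map_polyC comp_polyC.
- by move=> a x v w; rewrite aDr aZr map_polyC comp_polyC.
- by move=> x v; rewrite aZl map_polyX comp_polyX scaleNr.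
- by move=> x v; rewrite aZr map_polyX comp_polyX.
Qed.

Lemma CWZU p q i : p *: (<< q *g i >> : CW_carrier K) = << p * q *g i >>.
Proof.
by apply/malgP => k; rewrite mcoeffZ !mcoeffU mulrnAr.
Qed.

End SesqExt.

Section CW.
Variables (K : fieldType) (c : K).
Local Notation R := (CW_carrier K).
Local Notation br := (@CW_bracket K c).
Local Notation s0 := (c%:P%:P * (d1 K + lam1 K *+ 2)).

Let Fr (p : {poly K}) (i j : int) (q : {poly K}) : lpoly R :=
  (sesq p q * s0) *: lconst (CW_L K (i + j)).

Let FrD p i j : {morph Fr p i j : u v / u + v}.
Proof. by move=> u v; rewrite /Fr sesqDr mulrDl scalerDl. Qed.

Let Fl (y : R) (i : int) (p : {poly K}) : lpoly R :=
  \sum_(j <- msupp y) Fr p i j y@_j.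

Let FlD y i : {morph Fl y i : u v / u + v}.
Proof.
move=> u v; rewrite /Fl -big_split; apply: eq_bigr => j _.
by rewrite /Fr sesqDl mulrDl scalerDl.
Qed.

Lemma CW_bracketDl y : {morph br^~ y : x z / x + z}.
Proof. by move=> x z; apply: (msumD (FlD y)). Qed.

Lemma CW_bracketDr x : {morph br x : y z / y + z}.
Proof.
move=> y z; rewrite /CW_bracket -big_split; apply: eq_bigr => i _.
exact: (msumD (FrD x@_i i)).
Qed.

Lemma CW_bracketU p i q j : br << p *g i >> << q *g j >> =
  (sesq p q * s0) *: lconst (CW_L K (i + j)).
Proof. by rewrite [LHS](msumU (FlD _)) /Fl (msumU (FrD _ _)). Qed.

Lemma CW_bracketL i j : br (CW_L K i) (CW_L K j) =
  (c%:P%:P * (d1 K + lam1 K *+ 2)) *: lconst (CW_L K (i + j)).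
Proof. by rewrite CW_bracketU sesq11 mul1r. Qed.

Lemma CW_sesq : bilinear_lambda br /\ sesquilinear_lambda br.
Proof.
have br0l y : br 0 y = 0 by exact: (morph0D (CW_bracketDl y)).
have br0r x : br x 0 = 0 by exact: (morph0D (CW_bracketDr x)).
apply: sesq_axioms; [exact: CW_bracketDl | exact: CW_bracketDr | |].
- move=> p x y; elim/malg_ind: x => [|x z IHx IHz|i r].
  + by rewrite scaler0 !br0l scaler0.
  + by rewrite scalerDr !CW_bracketDl IHx IHz scalerDr.
  elim/malg_ind: y => [|y z IHy IHz|j q].
  + by rewrite !br0r scaler0.
  + by rewrite !CW_bracketDr IHy IHz scalerDr.
  by rewrite CWZU !CW_bracketU sesqZl scalerA !mulrA.
- move=> p x y; elim/malg_ind: y => [|y z IHy IHz|j q].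
  + by rewrite scaler0 !br0r scaler0.
  + by rewrite scalerDr !CW_bracketDr IHy IHz scalerDr.
  elim/malg_ind: x => [|x z IHx IHz|i r].
  + by rewrite !br0l scaler0.
  + by rewrite !CW_bracketDl IHx IHz scalerDr.
  by rewrite CWZU !CW_bracketU sesqZr scalerA !mulrA.
Qed.

Let polCC : {rmorphism K -> {poly {poly K}}} := polyC \o (polyC : K -> {poly K}).

Lemma ev1_d1 p : ev1 polCC (d1 K) p = p%:P.
Proof.
elim/poly_ind: p => [|p a IHp]; first by rewrite !rmorph0.
by rewrite rmorphD rmorphM /= ev1X ev1C IHp !polyCD !polyCM.
Qed.

Lemma lconstD (V : zmodType) : {morph @lconst V : u v / u + v}.
Proof. by move=> u v; rewrite /lconst monalgUD. Qed.

Lemma lconstZ (A : nzRingType) (V : lmodType A) a (u : V) :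
  lconst (a *: u) = a%:P *: lconst u.
Proof. by apply/malgP => n; rewrite lpolyZC !mcoeffU scalerMnr. Qed.

Lemma CW_skew x y : br x y = - lsubst (@lconst R) (br y x) (- lam1 K - d1 K).
Proof.
have [bil _] := CW_sesq.
have lD := @lconstD R.
elim/malg_ind: x => [|x z IHx IHz|i p].
- by rewrite (morph0D (actDl bil y)) (morph0D (actDr bil y)) lsubst0 oppr0.
- by rewrite (actDl bil) (actDr bil) (lsubstD lD) opprD IHx IHz.
elim/malg_ind: y => [|y z IHy IHz|j q].
- by rewrite (morph0D (actDl bil _)) (morph0D (actDr bil _)) lsubst0 oppr0.
- by rewrite (actDl bil) (actDr bil) (lsubstD lD) opprD IHy IHz.
have lZ : forall a (u : R), lconst (a *: u) = ev1 polCC (d1 K) a *: lconst u.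
  by move=> a u; rewrite ev1_d1 lconstZ.
rewrite !CW_bracketU (lsubstZ _ _ _ lD lZ) (lsubst_const lD) (addrC j i) -scaleNr.
congr (_ *: _).
change (sesq p q * s0 = - ev2 polCC (d1 K) (- lam1 K - d1 K) (sesq q p * s0)).
have sE r t : sesq r t = ev1 polCC (- lam1 K) r * ev1 polCC (d1 K + lam1 K) t.
  have E (w : {poly {poly K}}) a : ev1 polCC w a = a^:P \Po w.
    by rewrite /ev1 /comp_poly -map_poly_comp.
  by rewrite /sesq -!E.
rewrite ev2_sesqM ev2_vir sE.
have -> : - (- 'X - ('X%:P : {poly {poly K}})) = 'X%:P + 'X by ring.
have -> : 'X%:P + (- 'X - ('X%:P : {poly {poly K}})) = - 'X by ring.
rewrite /=; ring.
Qed.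

Lemma CW_axioms : lie_conformal_axioms br.
Proof.
have [bil ses] := CW_sesq.
split=> //; first exact: CW_skew.
move=> x y z.
elim/malg_ind: x => [|x x' IHx IHx'|i p].
- by rewrite (morph0D (act_actDx bil _ _ _ _)) (morph0D (bracket_actDx bil bil _ _))
    (morph0D (act_actDy bil _ _ _ _)) addr0.
- rewrite (act_actDx bil _ _ _ _ x x') (bracket_actDx bil bil _ _ x x').
  rewrite (act_actDy bil _ _ _ _ x x') IHx IHx'; exact: addrACA.
elim/malg_ind: y => [|y y' IHy IHy'|j q].
- by rewrite (morph0D (act_actDx bil _ _ _ _)) (morph0D (bracket_actDy bil bil _ _))
    (morph0D (act_actDy bil _ _ _ _)) addr0.
- rewrite (act_actDx bil _ _ _ _ y y') (bracket_actDy bil bil _ _ y y').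
  rewrite (act_actDy bil _ _ _ _ y y') IHy IHy'; exact: addrACA.
elim/malg_ind: z => [|z z' IHz IHz'|k r].
- by rewrite !(morph0D (act_actDv bil _ _ _ _)) (morph0D (bracket_actDv bil _ _ _)) addr0.
- rewrite !(act_actDv bil _ _ _ _ z z') (bracket_actDv bil _ _ _ z z').
  rewrite IHz IHz'; exact: addrACA.
rewrite (act_actE bil ses _ _ (CW_bracketU _ _ _ _) (CW_bracketU _ _ _ _)).
rewrite (act_actE bil ses _ _ (CW_bracketU _ _ _ _) (CW_bracketU _ _ _ _)).
rewrite (bracket_actE bil ses (CW_bracketU _ _ _ _) (CW_bracketU _ _ _ _)).
have -> : j + (i + k) = i + (j + k) by rewrite addrCA.
rewrite -(addrA i j k) -scalerDl; congr (_ *: _).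
rewrite !ev2_sesqM !ev2_vir !rmorph1.
rewrite [d2 K + lam2 K + mu2 K]addrAC.
have -> : - (lam2 K + mu2 K) + lam2 K = - mu2 K by ring.
have -> : d2 K + mu2 K + lam2 K = d2 K + (lam2 K + mu2 K) by ring.
move: (ev1 _ _ p) (ev1 _ _ q) (ev1 _ _ r) (pol3C K c) => *.
move: (d2 K) (lam2 K) (mu2 K) => *; ring.
Qed.

(* The Lie conformal algebra CW(0,c). *)
Definition CW : lieConformalAlgebra K := LieConformalAlgebra CW_axioms.

Section Rank1.
Variable f : int -> {poly {poly K}}.
Local Notation V := ({poly K}^o : lmodType {poly K}).
Local Notation act := (rank1_act f).
Local Notation iot := (pol3C K).
Local Notation e2 := (ev2 iot).

Let G (q : V) (i : int) (p : {poly K}) : lpoly V :=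
  (sesq p q * f i) *: lconst (1 : V).

Let GD q i : {morph G q i : u v / u + v}.
Proof. by move=> u v; rewrite /G sesqDl mulrDl scalerDl. Qed.

Lemma rank1_actU p i q :
  act << p *g i >> q = (sesq p q * f i) *: lconst (1 : V).
Proof. exact: (msumU (GD q)). Qed.

Lemma rank1_actL i : act (CW_L K i) 1 = f i *: lconst (1 : V).
Proof. by rewrite rank1_actU sesq11 mul1r. Qed.

Lemma rank1_sesq : bilinear_lambda act /\ sesquilinear_lambda act.
Proof.
have aDl v : {morph act^~ v : x y / x + y}.
  by move=> x y; apply: (msumD (GD v)).
have aDr x : {morph act x : v w / v + w}.
  move=> v w; rewrite /rank1_act -big_split; apply: eq_bigr => i _.
  by rewrite sesqDr mulrDl scalerDl.
apply: sesq_axioms => //.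
- move=> p x v; elim/malg_ind: x => [|x z IHx IHz|i r].
  + by rewrite scaler0 (morph0D (aDl v)) scaler0.
  + by rewrite scalerDr !aDl IHx IHz scalerDr.
  by rewrite CWZU !rank1_actU sesqZl scalerA !mulrA.
- move=> p x v; elim/malg_ind: x => [|x z IHx IHz|i r].
  + by rewrite !(morph0D (aDl _)) scaler0.
  + by rewrite !aDl IHx IHz scalerDr.
  by rewrite !rank1_actU sesqZr scalerA !mulrA.
Qed.

Hypothesis fP : forall i j,
  e2 (d2 K + lam2 K) (mu2 K) (f j) * e2 (d2 K) (lam2 K) (f i)
  - e2 (d2 K + mu2 K) (lam2 K) (f i) * e2 (d2 K) (mu2 K) (f j)
  = iot c * (lam2 K - mu2 K) * e2 (d2 K) (lam2 K + mu2 K) (f (i + j)).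

Lemma rank1_axioms : conformal_module_axioms (R := CW) act.
Proof.
have [bil ses] := rank1_sesq.
have [bilb _ _ _] := CW_axioms.
split=> // x y v.
elim/malg_ind: x => [|x x' IHx IHx'|i p].
- by rewrite (morph0D (act_actDx bil _ _ _ _)) (morph0D (bracket_actDx bil bilb _ _))
    (morph0D (act_actDy bil _ _ _ _)) subr0.
- rewrite (act_actDx bil _ _ _ _ x x') (bracket_actDx bil bilb _ _ x x').
  by rewrite (act_actDy bil _ _ _ _ x x') -IHx -IHx' opprD addrACA.
elim/malg_ind: y => [|y y' IHy IHy'|j q].
- by rewrite (morph0D (act_actDx bil _ _ _ _)) (morph0D (bracket_actDy bil bilb _ _))
    (morph0D (act_actDy bil _ _ _ _)) subr0.
- rewrite (act_actDx bil _ _ _ _ y y') (bracket_actDy bil bilb _ _ y y').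
  by rewrite (act_actDy bil _ _ _ _ y y') -IHy -IHy' opprD addrACA.
rewrite (act_actE bil ses _ _ (rank1_actU _ _ _) (rank1_actU _ _ _)).
rewrite (act_actE bil ses _ _ (rank1_actU _ _ _) (rank1_actU _ _ _)).
rewrite (bracket_actE bil ses (CW_bracketU _ _ _ _) (rank1_actU _ _ _)).
rewrite -scalerBl; congr (_ *: _).
have := fP i j.
rewrite !ev2_sesqM ev2_vir !rmorph1.
set a1 := e2 _ _ (f j); set a2 := e2 _ _ (f i); set a3 := e2 _ _ (f i).
set a4 := e2 _ _ (f j); set a5 := e2 _ _ (f _) => fE.
rewrite [d2 K + lam2 K + mu2 K]addrAC.
have -> : - (lam2 K + mu2 K) + lam2 K = - mu2 K by ring.
have -> : d2 K + mu2 K + lam2 K = d2 K + (lam2 K + mu2 K) by ring.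
set v1 := ev1 _ _ v; set p1 := ev1 _ _ p; set q1 := ev1 _ _ q.
transitivity (p1 * q1 * v1 * (a1 * a2 - a3 * a4)); first by ring.
rewrite fE; ring.
Qed.

Definition rank1_module : conformalModule CW := ConformalModule rank1_axioms.

End Rank1.
End CW.

Section Families.
Variable K : fieldType.

Fact mod_h_subproof (h : int -> {poly K}) (c : K) (c0 : c = 0) i j :
  let f i := (h i)^:P in let e2 := ev2 (pol3C K) in
  e2 (d2 K + lam2 K) (mu2 K) (f j) * e2 (d2 K) (lam2 K) (f i)
  - e2 (d2 K + mu2 K) (lam2 K) (f i) * e2 (d2 K) (mu2 K) (f j)
  = pol3C K c * (lam2 K - mu2 K) * e2 (d2 K) (lam2 K + mu2 K) (f (i + j)).
Proof. by rewrite /= !ev2_lift c0 rmorph0 !mul0r mulrC subrr. Qed.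

(* L_i_lambda v = h_i(lambda) v; a CW(0,c)-module only for c = 0. *)
Definition mod_h (c : K) (c0 : c = 0) (h : int -> {poly K}) :
    conformalModule (CW c) :=
  rank1_module (mod_h_subproof h c0).

Lemma mod_h_L (c : K) (c0 : c = 0) h i :
  cm_act (c := mod_h c0 h) (CW_L K i) (1 : {poly K}^o) =
  (h i)^:P *: lconst (1 : {poly K}^o).
Proof. exact: rank1_actL. Qed.

Definition trs_poly (c tau rho sigma : K) (i : int) : {poly {poly K}} :=
  (tau ^ i)%:P%:P *
  (c%:P%:P * d1 K + rho%:P%:P * lam1 K + sigma%:P%:P).

Lemma ev2_trs (B : comNzRingType) (iota : {rmorphism K -> B}) s t c tau rho
    sigma i :
  ev2 iota s t (trs_poly c tau rho sigma i) =
  iota (tau ^ i) * (iota c * s + iota rho * t + iota sigma).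
Proof. by rewrite /trs_poly ev2M !ev2D !ev2M !ev2C ev2X !ev1C ev1X. Qed.

Fact mod_trs_subproof (c tau : K) (tau0 : tau != 0) (rho sigma : K) i j :
  let f := trs_poly c tau rho sigma in let e2 := ev2 (pol3C K) in
  e2 (d2 K + lam2 K) (mu2 K) (f j) * e2 (d2 K) (lam2 K) (f i)
  - e2 (d2 K + mu2 K) (lam2 K) (f i) * e2 (d2 K) (mu2 K) (f j)
  = pol3C K c * (lam2 K - mu2 K) * e2 (d2 K) (lam2 K + mu2 K) (f (i + j)).
Proof.
move=> f e2; rewrite /e2 /f !ev2_trs expfzDr //.
have -> : pol3C K (tau ^ i * tau ^ j) = pol3C K (tau ^ i) * pol3C K (tau ^ j).
  exact: rmorphM.
move: (pol3C K (tau ^ i)) (pol3C K (tau ^ j)) (pol3C K c) (pol3C K rho).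
move: (pol3C K sigma) (d2 K) (lam2 K) (mu2 K) => *; ring.
Qed.

(* L_i_lambda v = tau^i (c d + rho lambda + sigma) v; tau <> 0 is needed for
   i |-> tau^i to be multiplicative on Z. *)
Definition mod_trs (c tau : K) (tau0 : tau != 0) (rho sigma : K) :
    conformalModule (CW c) :=
  rank1_module (mod_trs_subproof c tau0 rho sigma).

Lemma mod_trs_L (c tau : K) (tau0 : tau != 0) rho sigma i :
  cm_act (c := mod_trs c tau0 rho sigma) (CW_L K i) (1 : {poly K}^o) =
  trs_poly c tau rho sigma i *: lconst (1 : {poly K}^o).
Proof. exact: rank1_actL. Qed.

End Families.

(* Main.v *)
Require Import Defs.
From HB Require Import structures.
From mathcomp Require Import all_boot all_order all_algebra.
From mathcomp Require Import finmap monalg ring zify.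
From mathcomp Require Import boolp complex reals.

Set Implicit Arguments.
Unset Strict Implicit.
Unset Printing Implicit Defensive.

Import GRing.Theory.
Local Open Scope ring_scope.

(** If [v] generates [M] over C[d], the whole module structure is encoded by the
    polynomials [f_i(d, lambda)] with [L_i _lambda v = f_i v], and the Jacobi
    identity becomes the functional equation
      [f_j(d + s, t) f_i(d, s) - f_i(d + t, s) f_j(d, t)
         = c (s - t) f_(i+j)(d, s + t)].
    Since it is a polynomial identity, it may be specialized to any values of
    [d], [s], [t] in any commutative C-algebra.  Two specializations suffice.

    Doubling, [t = 2 s] and [i = j] ([rank1_doubling]).  Both sides are now
    polynomials in [d] over the domain C[s].  If [f_i] has degree [n >= 1] in [d]
    with leading coefficient [a], the terms of degree [2n] on the left cancel, and
    the coefficient of degree [2n - 1] is [- n s a(s) a(2s)], which is nonzero.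
    When [c = 0] this contradicts the equation, so [f_i] does not involve [d]
    ([rank1_abelian]).  When [c <> 0] and [i = 0] it forces [n <= 1], as the right
    hand side has degree at most [n] in [d].  Writing [f_0 = a(lambda) d + b(lambda)],
    the equation reduces to [a(s) a(2s) = c a(3s)], whose only nonzero
    solution is [a = c] ([a = 0] would give [f_0 = 0]), and then to
    [b(s) - 2 b(2s) + b(3s) = 0], which leaves only affine [b] because
    [1 + 3^k <> 2^(k+1)] for [k >= 2].  Hence [f_0 = c d + rho lambda + sigma]
    ([rank1_virasoro]).

    Vanishing, [t = 0] ([rank1_at0]).  With [g(d) = f_j(d, 0)] and [i = 0], it reads
    [(g(d + s) - g(d)) f_0(d, s) = c s f_j(d, s)].  The terms of order one in [s]
    give [c g = (c d + sigma) g'], so [g] is a multiple of [c d + sigma]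
    and then [f_j] is a scalar multiple [r_j f_0] of [f_0].  Nontriviality thus gives
    [f_0 <> 0]; substituting back, [r] is multiplicative on the integers, so
    [r_j = tau ^ j] ([rank1_powers]).

    Irreducibility excludes [rho = 0]: otherwise all [f_i] would be divisible by
    [p = c d + sigma], and [p M] would be a proper nonzero submodule
    ([irreducible_divisor]). *)

(** * Translation and dilation of polynomials *)

(** The second equality is the Taylor expansion [p(X + r) = p + r p' + ...], whose
    remainder has degree at most [n - 1]. *)
Lemma coef_shift_top (A : idomainType) (p : {poly A}) (r : A) n :
  (size p <= n.+2)%N ->
  (p \Po ('X + r%:P))`_n.+1 = p`_n.+1 /\
  (p \Po ('X + r%:P))`_n = p`_n + (r * p`_n.+1) *+ n.+1.
Proof.
elim/poly_ind: p n => [|q a IHq] n; first by rewrite comp_poly0 !coef0 mulr0 mul0rn addr0.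
have [-> _|q_neq0] := eqVneq q 0.
  by rewrite mul0r add0r comp_polyC !coefC /= mulr0 mul0rn addr0.
rewrite size_MXaddC (negbTE q_neq0) /= ltnS => le_q.
have coefS k : ((q * 'X + a%:P) \Po ('X + r%:P))`_k.+1 =
    (q \Po ('X + r%:P))`_k + r * (q \Po ('X + r%:P))`_k.+1.
  rewrite comp_polyD comp_polyM comp_polyX comp_polyC mulrDr !coefD coefC addr0.
  by rewrite coefMX coefMC mulrC.
have out k : (size q <= k)%N -> (q \Po ('X + r%:P))`_k = 0.
  by move=> le_k; apply: nth_default; rewrite size_comp_poly2 ?size_XaddC.
have coef0S k : (q * 'X + a%:P)`_k.+1 = q`_k by rewrite coefD coefMX coefC addr0.
case: n le_q => [|n] le_q; rewrite !coefS !coef0S.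
  have q0 : (q \Po ('X + r%:P))`_0 = q`_0.
    by rewrite (size1_polyC le_q) comp_polyC.
  rewrite (out 1%N) // mulr0 addr0 q0; split=> //.
  rewrite comp_polyD comp_polyM comp_polyX comp_polyC mulrDr !coefD coefMX coefMC.
  by rewrite q0 coefMX !coefC /= !add0r mulr1n mulrC addrC.
have [IHt IHn] := IHq n le_q.
rewrite (out n.+2) // mulr0 addr0 IHt IHn; split=> //.
by rewrite -addrA -mulrSr.
Qed.

Lemma coefM_below_top (A : comNzRingType) (p q : {poly A}) n :
  (size p <= n.+2)%N -> (size q <= n.+2)%N ->
  (p * q)`_(n + n.+1) = p`_n * q`_n.+1 + p`_n.+1 * q`_n.
Proof.
move=> le_p le_q; rewrite coefM.
have ltn1 : (n < (n + n.+1).+1)%N by lia.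
have ltn2 : (n.+1 < (n + n.+1).+1)%N by lia.
rewrite (bigD1 (Ordinal ltn1)) //= addKn.
rewrite (bigD1 (Ordinal ltn2)) //=; last by rewrite -val_eqE /=; lia.
have -> : (n + n.+1 - n.+1)%N = n by lia.
rewrite big1 ?addr0 // => i; rewrite -!val_eqE /= => /andP[i1 i2].
have [lt_i|le_i] := ltnP i n.
  by rewrite (nth_default _ (leq_trans le_q _)) ?mulr0 //; lia.
by rewrite (nth_default _ (leq_trans le_p _)) ?mul0r //; lia.
Qed.

(** The two products have the same top coefficient, so what survives just below
    the top comes from the first-order terms [r q'] and [s p'] of the two
    translations. *)
Lemma coef_shift_commutator (A : idomainType) (p q : {poly A}) (r s : A) n :
  (size p <= n.+2)%N -> (size q <= n.+2)%N ->
  ((q \Po ('X + r%:P)) * p - (p \Po ('X + s%:P)) * q)`_(n + n.+1) =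
  ((r - s) * (p`_n.+1 * q`_n.+1)) *+ n.+1.
Proof.
move=> le_p le_q.
have le_shift (u : {poly A}) x : (size u <= n.+2)%N -> (size (u \Po ('X + x%:P)) <= n.+2)%N.
  by rewrite size_comp_poly2 ?size_XaddC.
rewrite coefB !coefM_below_top ?le_shift //.
have [-> ->] := coef_shift_top r le_q.
have [-> ->] := coef_shift_top s le_p.
ring.
Qed.

Lemma coef_Taylor1 (A : comNzRingType) (p : {poly A}) :
  (p^:P \Po ('X%:P + 'X))`_0 = p /\ (p^:P \Po ('X%:P + 'X))`_1 = p^`().
Proof.
elim/poly_ind: p => [|p a [IH0 IH1]].
  by rewrite rmorph0 comp_poly0 deriv0 !coef0.
rewrite rmorphD rmorphM /= map_polyX map_polyC comp_polyD comp_polyM comp_polyX comp_polyC.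
rewrite derivMXaddC mulrDr !coefD !coefMX !coefMC !coefC /= IH0 IH1.
by split; rewrite !addr0 // addrC.
Qed.

Section Scaling.
Variable K : fieldType.

Lemma coef_comp_scale (k : K) (p : {poly K}) i : (p \Po (k *: 'X))`_i = k ^+ i * p`_i.
Proof.
elim/poly_ind: p i => [|p a IHp] i; first by rewrite comp_poly0 !coef0 mulr0.
rewrite comp_polyD comp_polyM comp_polyX comp_polyC -scalerAr !coefD coefZ !coefMX coefC.
case: i => [|i] /=; first by rewrite mulr0 !add0r expr0 mul1r.
by rewrite IHp !addr0 exprS mulrA.
Qed.

Lemma size_comp_scale (k : K) (p : {poly K}) : k != 0 -> size (p \Po (k *: 'X)) = size p.
Proof. by move=> k0; rewrite size_comp_poly2 // size_scale // size_polyX. Qed.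

Lemma comp_scale_eq0 (k : K) (p : {poly K}) : k != 0 -> (p \Po (k *: 'X) == 0) = (p == 0).
Proof. by move=> k0; rewrite -!size_poly_eq0 size_comp_scale. Qed.

End Scaling.

Section CharZero.
Variable K : fieldType.
Hypothesis charK : [pchar K] =i pred0.

Lemma natr_neq0 n : (n.+1%:R : K) != 0.
Proof. by have /pcharf0P-> := charK. Qed.

(** A nonzero solution has degree [n] with [2n = n], and a nonzero constant [a]
    satisfies [a^2 = c a]. *)
Lemma dilation_const (c : K) (a : {poly K}) : a != 0 ->
  a * (a \Po (2%:R *: 'X)) = c *: (a \Po (3%:R *: 'X)) -> a = c%:P.
Proof.
move=> a0 eq_a.
have k2 := natr_neq0 1; have k3 := natr_neq0 2.
have a20 : a \Po (2%:R *: 'X) != 0 by rewrite comp_scale_eq0.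
have c0 : c != 0.
  by apply: contra_eq_neq eq_a => ->; rewrite scale0r mulf_neq0.
have := congr1 (fun p : {poly K} => size p) eq_a.
rewrite size_scale // size_mul // !size_comp_scale // => sz.
have sz1 : (size a <= 1)%N.
  by move: sz a0; rewrite -size_poly_eq0; case: (size a) => [|[|n]] //=; lia.
move: eq_a a0; rewrite (size1_polyC sz1) !comp_polyC -mul_polyC -!polyCM.
by move=> /polyC_inj eq_a; rewrite polyC_eq0 => a0; congr (_%:P); apply: (mulIf a0).
Qed.

Lemma pow2_lt_pow3 k : (2 ^ k.+3 < 3 ^ k.+2 + 1)%N.
Proof. elim: k => [//|k IH]; rewrite expnS [(3 ^ k.+3)%N]expnS; lia. Qed.

(** On the coefficient of degree [k] the operator acts by [1 - 2^(k+1) + 3^k], which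
    vanishes only for [k <= 1]. *)
Lemma dilation_affine (b : {poly K}) :
  b - (b \Po (2%:R *: 'X)) *+ 2 + (b \Po (3%:R *: 'X)) = 0 ->
  (size b <= 2)%N.
Proof.
move=> eq_b; apply/leq_sizeP => -[|[|k]] // _.
have := congr1 (fun p : {poly K} => p`_k.+2) eq_b.
rewrite coefD coefB coefMn !coef_comp_scale coef0.
have -> : b`_k.+2 - 2 ^+ k.+2 * b`_k.+2 *+ 2 + 3 ^+ k.+2 * b`_k.+2 =
  (3 ^+ k.+2 + 1 - 2 ^+ k.+3) * b`_k.+2 by rewrite [2 ^+ k.+3]exprS; ring.
move/eqP; rewrite mulf_eq0 => /orP[|/eqP//].
rewrite -!natrX natr1 -natrB; last by have := pow2_lt_pow3 k; lia.
have lt := pow2_lt_pow3 k.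
by rewrite -(prednK (n := (_ - _)%N)) ?(negbTE (natr_neq0 _)) //; lia.
Qed.

(** Comparing leading coefficients, a solution of degree [n] satisfies [c = c n],
    so it is zero or of degree one; its constant term is then determined. *)
Lemma euler_ode (c sigma : K) (g : {poly K}) : c != 0 ->
  c *: g = (c *: 'X + sigma%:P) * g^`() ->
  exists t, g = t *: (c *: 'X + sigma%:P).
Proof.
move=> c0 eq_g.
have coefg k : c * g`_k = (c * g`_k) *+ k + (sigma * g`_k.+1) *+ k.+1.
  have := congr1 (fun p : {poly K} => p`_k) eq_g.
  rewrite coefZ mulrDl -scalerAl [_ * g^`()]mulrC mul_polyC coefD !coefZ coefMX !coef_deriv => eq_k.
  apply: (etrans eq_k).
  case: k {eq_k} => [|k] /=; rewrite ?coef_deriv !mulrnAr ?mulr0 ?mulr0n ?add0r //.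
have sz : (size g <= 2)%N.
  case E: (size g) => [|[|[|n]]] //.
  have lg : g`_n.+2 != 0.
    by have := lead_coef_eq0 g; rewrite lead_coefE E -size_poly_eq0 E => ->.
  have := coefg n.+2; rewrite [g`_n.+3]nth_default ?E // mulr0 mul0rn addr0.
  move=> /eqP; rewrite mulrS -subr_eq0 opprD addrA subrr sub0r oppr_eq0 -mulr_natl.
  by rewrite !mulf_eq0 (negbTE (natr_neq0 _)) (negbTE c0) (negbTE lg).
exists (g`_1 / c); apply/polyP => -[|[|k]].
- rewrite coefZ coefD coefZ coefX coefC /= mulr0 add0r.
  apply: (mulfI c0); rewrite coefg /= mulr0n add0r mulr1n; field; exact: c0.
- by rewrite coefZ coefD coefZ coefX coefC /= mulr1 addr0 divfK.
rewrite nth_default ?(leq_trans sz) // coefZ coefD coefZ coefX coefC /=.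
by rewrite mulr0 addr0 mulr0.
Qed.

End CharZero.

(** * The functional equation of a rank one module *)

Section Ev2.
Variables (K : fieldType) (A B : comNzRingType).

Lemma eq_ev2 (iota kappa : {rmorphism K -> B}) s t :
  iota =1 kappa -> ev2 iota s t =1 ev2 kappa s t.
Proof.
move=> eq_ik P; congr (_.[t]); apply: eq_map_poly => p.
by congr (_.[s]); apply: eq_map_poly.
Qed.

Lemma ev2_morph (iota : {rmorphism K -> A}) (theta : {rmorphism A -> B}) s t P :
  theta (ev2 iota s t P) = ev2 (theta \o iota) (theta s) (theta t) P.
Proof.
rewrite /ev2 -horner_map -map_poly_comp; congr (_.[_]); apply: eq_map_poly => p /=.
by rewrite /ev1 -horner_map -map_poly_comp.
Qed.

End Ev2.

Lemma ev1_id (K : fieldType) (p : {poly K}) : ev1 (polyC \o polyC) (d1 K) p = p%:P.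
Proof. by rewrite /ev1 map_poly_comp horner_map -/(comp_poly _ _) comp_polyXr. Qed.

Lemma ev2_id (K : fieldType) (P : {poly {poly K}}) :
  ev2 (polyC \o polyC) (d1 K) (lam1 K) P = P.
Proof.
elim/poly_ind: P => [|P p IHP]; first by rewrite rmorph0.
by rewrite ev2D ev2M ev2X ev2C IHP ev1_id.
Qed.

Lemma ev2_at0 (K : fieldType) (B : comNzRingType) (iota : {rmorphism K -> B}) s P :
  ev2 iota s 0 P = ev1 iota s P`_0.
Proof. by rewrite /ev2 horner_coef0 coef_map. Qed.

Lemma ev1_comp (K : fieldType) (q : {poly {poly K}}) p :
  ev1 (polyC \o polyC) q p = p^:P \Po q.
Proof. by rewrite /ev1 /comp_poly -map_poly_comp. Qed.

(** Quantifying over the values [s], [t], [u] of [d], [lambda], [mu] in an arbitrary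
    commutative K-algebra makes every specialization an instance. *)
Definition rank1_equation (K : fieldType) (c : K) (f : int -> {poly {poly K}}) :=
  forall (B : comNzRingType) (iota : {rmorphism K -> B}) (s t u : B) i j,
  ev2 iota (s + t) u (f j) * ev2 iota s t (f i)
  - ev2 iota (s + u) t (f i) * ev2 iota s u (f j)
  = iota c * (t - u) * ev2 iota s (t + u) (f (i + j)).

Lemma rank1_equation_generic (K : fieldType) (c : K) (f : int -> {poly {poly K}}) :
  (forall i j, let e2 := ev2 (pol3C K) in
   e2 (d2 K + lam2 K) (mu2 K) (f j) * e2 (d2 K) (lam2 K) (f i)
   - e2 (d2 K + mu2 K) (lam2 K) (f i) * e2 (d2 K) (mu2 K) (f j)
   = pol3C K c * (lam2 K - mu2 K) * e2 (d2 K) (lam2 K + mu2 K) (f (i + j))) ->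
  rank1_equation c f.
Proof.
move=> fE B iota s t u i j.
have cu : commr_rmorph (ev2 iota s t) u by move=> P; apply: mulrC.
pose theta : {rmorphism {poly {poly {poly K}}} -> B} := horner_morph cu.
have thetaC : theta \o pol3C K =1 iota.
  by move=> a /=; rewrite horner_morphC /= ev2C ev1C.
have thetad : theta (d2 K) = s by rewrite /= horner_morphC /= ev2C ev1X.
have thetal : theta (lam2 K) = t by rewrite /= horner_morphC /= ev2X.
have thetam : theta (mu2 K) = u by rewrite /= horner_morphX.
clearbody theta.
have := congr1 theta (fE i j); cbv zeta.
rewrite rmorphB (rmorphM theta (ev2 _ _ _ (f j))) (rmorphM theta (ev2 _ _ _ (f i))).
rewrite 2!(rmorphM theta) (rmorphB theta (lam2 K)) !(ev2_morph _ theta).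
rewrite !(eq_ev2 _ _ thetaC) !(rmorphD theta) thetad thetal thetam.
by rewrite -[theta _]/((theta \o pol3C K) c) thetaC.
Qed.

Section Equation.
Variable K : fieldType.
Hypothesis charK : [pchar K] =i pred0.
Local Notation dil k := (map_poly (comp_poly (k *: 'X : {poly K}))).
Local Notation CC := (polyC \o polyC : {rmorphism K -> {poly {poly K}}}).

(** After exchanging the variables [d] is the outer one, so evaluating at
    [d + r(lambda)] and [w(lambda)] composes the coefficients with [w] and then
    translates by [r]. *)
Lemma ev2_swap (r w : {poly K}) f :
  ev2 CC ('X + r%:P) w%:P f = map_poly (comp_poly w) (swapXY f) \Po ('X + r%:P).
Proof.
elim/poly_ind: f => [|f a IHf]; first by rewrite !rmorph0.
rewrite ev2D ev2M ev2X ev2C IHf ev1_comp !rmorphD !rmorphM /= swapXY_X swapXY_polyC.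
rewrite map_polyC /= comp_polyX comp_polyC; congr (_ + (_ \Po _)).
by apply/esym; rewrite -map_poly_comp; apply: eq_map_poly => x /=; rewrite comp_polyC.
Qed.

Section Dilation.
Variables (c : K) (f : int -> {poly {poly K}}).
Hypothesis fE : rank1_equation c f.
Variable i : int.
(* F and G are polynomials in d with coefficients in K[lambda]. *)
Let F := swapXY (f i).
Let G := swapXY (f (i + i)).

(** The specialization [mu = 2 lambda]: keeping [lambda] as a parameter yields an
    identity in [d] over a domain in which [lambda - mu] is still nonzero. *)
Lemma rank1_doubling :
  (dil 2%:R F \Po ('X + 'X%:P)) * F - (F \Po ('X + (2%:R *: 'X)%:P)) * dil 2%:R F =
  (- c *: 'X)%:P * dil 3%:R G.
Proof.
have swap0 w h : ev2 CC 'X w%:P h = map_poly (comp_poly w) (swapXY h).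
  by rewrite -[X in ev2 _ X](addr0) -(polyC0 {poly K}) ev2_swap polyC0 addr0 comp_polyXr.
have dilX h : map_poly (comp_poly 'X) h = h :> {poly {poly K}}.
  by apply: map_poly_id => p _ /=; rewrite comp_polyXr.
have := fE CC 'X 'X%:P (2%:R *: 'X)%:P i i.
rewrite -!polyCD !ev2_swap !swap0 !dilX => ->.
have -> : 'X + 2%:R *: 'X = 3%:R *: 'X :> {poly K} by rewrite -!mul_polyC !polyC_natr; ring.
congr (_ * _); rewrite /= -polyCB -polyCM; congr (_%:P).
by rewrite -!mul_polyC polyC_natr polyCN; ring.
Qed.

Lemma rank1_top n : (size F <= n.+2)%N ->
  (F`_n.+1 * (F`_n.+1 \Po (2%:R *: 'X))) *+ n.+1 =
  c *: (G`_(n + n.+1) \Po (3%:R *: 'X)).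
Proof.
move=> le_F; have := congr1 (fun p : {poly {poly K}} => p`_(n + n.+1)) rank1_doubling.
have le_dil : (size (dil 2%:R F) <= n.+2)%N by apply: leq_trans (size_poly _ _) le_F.
rewrite coef_shift_commutator // coefCM !coef_map /= => eq_top.
have X0 : - 'X != 0 :> {poly K} by rewrite oppr_eq0 polyX_eq0.
apply: (mulfI X0); move: eq_top; rewrite mulrnAr.
have -> : 'X - 2%:R *: 'X = - 'X :> {poly K} by rewrite -mul_polyC polyC_natr; ring.
by move=> ->; rewrite -scalerAr scalerAl scalerN scaleNr.
Qed.

Lemma rank1_bottom : (size F <= 2)%N ->
  (F`_1 \Po (2%:R *: 'X)) * F`_0 - (F`_1 * (F`_0 \Po (2%:R *: 'X))) *+ 2 =
  - c *: (G`_0 \Po (3%:R *: 'X)).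
Proof.
move=> le_F; have := congr1 (fun p : {poly {poly K}} => p`_0) rank1_doubling.
have le_dil : (size (dil 2%:R F) <= 2)%N by apply: leq_trans (size_poly _ _) le_F.
rewrite coefB !coef0M.
have [_ ->] := coef_shift_top 'X le_dil.
have [_ ->] := coef_shift_top (2%:R *: 'X) le_F.
rewrite coefC /= !coef_map /= => eq_bot.
have X0 : 'X != 0 :> {poly K} by rewrite polyX_eq0.
apply: (mulfI X0); rewrite -[RHS]scalerAr scalerAl -eq_bot.
by rewrite -!mul_polyC polyC_natr; ring.
Qed.

(** One step of the descent on the [d]-degree [n + 1] of [f_i]: the coefficient of
    degree [2n + 1] is killed on the right, either by [c = 0] or because the
    [d]-degree of [f_(i+i)] is smaller. *)
Lemma rank1_deg_le n :
  (c = 0 \/ (size G <= n + n.+1)%N) -> (size F <= n.+2)%N -> (size F <= n.+1)%N.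
Proof.
move=> cG le_F; have eq_top := rank1_top le_F.
have F0 : F`_n.+1 == 0.
  have: (F`_n.+1 * (F`_n.+1 \Po (2%:R *: 'X))) *+ n.+1 == 0.
    rewrite eq_top; case: cG => [->|le_G]; first by rewrite scale0r.
    by rewrite nth_default // comp_poly0 scaler0.
  rewrite -mulr_natl -polyC_natr !mulf_eq0 polyC_eq0 (negbTE (natr_neq0 charK _)).
  by rewrite comp_scale_eq0 ?(natr_neq0 charK 1) // orbb.
move: le_F; rewrite leq_eqVlt => /orP[/eqP sz|//].
by move: F0; rewrite -[n.+1]/n.+2.-1 -sz -lead_coefE lead_coef_eq0 -size_poly_eq0 sz.
Qed.

End Dilation.

Lemma rank1_abelian (f : int -> {poly {poly K}}) :
  rank1_equation 0 f -> forall i, f i = ((swapXY (f i))`_0)^:P.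
Proof.
move=> fE i.
have le_1 n : (size (swapXY (f i)) <= n.+1)%N -> (size (swapXY (f i)) <= 1)%N.
  by elim: n => // n IHn /(rank1_deg_le fE (or_introl erefl))/IHn.
by rewrite -swapXY_polyC -(size1_polyC (le_1 _ (leqnSn _))) swapXYK.
Qed.

(** The specialization [mu = 0], in which [f_i] becomes a common factor on the
    left. *)
Lemma rank1_at0 (c : K) (f : int -> {poly {poly K}}) : rank1_equation c f ->
  forall i j, ((((f j)`_0)^:P \Po (d1 K + lam1 K)) - ((f j)`_0)%:P) * f i =
    c%:P%:P * lam1 K * f (i + j).
Proof.
move=> fE i j; have := fE _ CC (d1 K) (lam1 K) 0 i j.
rewrite !addr0 subr0 !ev2_at0 !ev2_id ev1_id ev1_comp => eq_ij.
by rewrite mulrBl [_%:P * f i]mulrC eq_ij.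
Qed.

Lemma rank1_degenerate (c : K) (f : int -> {poly {poly K}}) :
  c != 0 -> rank1_equation c f -> f 0 = 0 -> forall i, f i = 0.
Proof.
move=> c0 fE f0 i; have := rank1_at0 fE 0 i; rewrite f0 mulr0 add0r => /esym/eqP.
by rewrite !mulf_eq0 !polyC_eq0 polyX_eq0 (negbTE c0) => /eqP.
Qed.

Section Virasoro.
Variables (c : K) (f : int -> {poly {poly K}}).
Hypotheses (c_neq0 : c != 0) (fE : rank1_equation c f) (f0_neq0 : f 0 != 0).

Lemma rank1_virasoro :
  exists rho sigma : K, f 0 = c%:P%:P * d1 K + rho%:P%:P * lam1 K + sigma%:P%:P.
Proof.
pose F := swapXY (f 0).
have le_2 n : (size F <= n.+2)%N -> (size F <= 2)%N.
  elim: n => // n IHn le_F; apply/IHn/(rank1_deg_le fE _ le_F).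
  (* Here f_(0+0) = f_0, and its degree is at most n + 2, below 2 (n + 1) + 1. *)
  by right; rewrite addr0; apply: leq_trans le_F _; lia.
have szF : (size F <= 2)%N by apply: (@le_2 (size F)); apply: ltnW; apply: leqnSn.
have := rank1_top fE szF; have := rank1_bottom fE szF.
rewrite addr0 -/F add0n mulr1n => eq_b eq_a.
have a_neq0 : F`_1 != 0.
  apply: contraNneq f0_neq0 => a0; move: eq_b; rewrite a0 comp_poly0 !mul0r mul0rn subr0.
  move/esym/eqP; rewrite scaler_eq0 oppr_eq0 (negbTE c_neq0) /=.
  rewrite comp_scale_eq0 ?(natr_neq0 charK 2) // => /eqP b0.
  rewrite -(swapXYK (f 0)) -/F swapXY_eq0; apply/eqP/polyP => -[|[|k]]; rewrite coef0 //.
  by rewrite nth_default // (leq_trans szF).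
have a_c := dilation_const charK a_neq0 eq_a.
pose b := F`_0.
have szb : (size b <= 2)%N.
  have cP0 : c%:P != 0 :> {poly K} by rewrite polyC_eq0.
  apply: (dilation_affine charK); apply: (mulfI cP0).
  move: eq_b; rewrite a_c comp_polyC scaleNr -[c *: _]mul_polyC => eq_b.
  by rewrite mulr0 mulrDr mulrBr mulrnAr eq_b addNr.
exists (F`_0)`_1, (F`_0)`_0.
have FE : F = c%:P%:P * 'X + (F`_0)%:P.
  apply/polyP => -[|[|k]]; rewrite coefD coefCM coefX coefC /= ?mulr0 ?add0r //.
    by rewrite mulr1 addr0.
  by rewrite nth_default // (leq_trans szF).
have bE : F`_0 = ((F`_0)`_1)%:P * 'X + ((F`_0)`_0)%:P.
  apply/polyP => -[|[|k]]; rewrite coefD coefCM coefX coefC /= ?mulr0 ?add0r //.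
    by rewrite mulr1 addr0.
  by rewrite nth_default // (leq_trans szb).
rewrite -(swapXYK (f 0)) -/F {1}FE rmorphD rmorphM /=.
rewrite swapXY_X !swapXY_polyC map_polyC {1}bE rmorphD rmorphM /=.
by rewrite !map_polyC map_polyX /= addrA.
Qed.

Lemma rank1_multiple i : exists t : K, f i = t%:P%:P * f 0.
Proof.
have [rho [sigma f0E]] := rank1_virasoro.
pose g := (f i)`_0.
have eq_g : ((g^:P \Po (d1 K + lam1 K)) - g%:P) * f 0 = c%:P%:P * (lam1 K * f i).
  by rewrite (rank1_at0 fE) add0r mulrA.
have [g0 g1] := coef_Taylor1 g.
have [t gE] : exists t, g = t *: (c *: 'X + sigma%:P).
  apply: (euler_ode charK c_neq0).
  (* The coefficient of lambda on both sides. *)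
  have := congr1 (fun P : {poly {poly K}} => P`_1) eq_g.
  rewrite coefCM coefXM coefM !big_ord_recl big_ord0 /= !coefB g0 g1 !coefC /= subrr.
  rewrite mul0r add0r addr0 subr0 -/g => /esym; rewrite mul_polyC => ->.
  rewrite mulrC f0E !coefD !coefCM !coefC coefX /= mulr0 addr0.
  by rewrite mul_polyC.
have cl0 : c%:P%:P * lam1 K != 0 :> {poly {poly K}}.
  by rewrite mulf_neq0 ?polyX_eq0 // !polyC_eq0.
exists t; apply: (mulfI cl0); rewrite -mulrA -eq_g gE -!mul_polyC.
rewrite !(rmorphD, rmorphM) /= !map_polyC map_polyX /=.
rewrite !comp_polyC comp_polyX; ring.
Qed.

(** At [mu = 0] the equation for [t_i f_0] and [t_j f_0] is [t_i t_j] times the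
    equation for [f_0] itself. *)
Lemma rank1_scalar_morph (t : int -> K) :
  (forall i, f i = (t i)%:P%:P * f 0) -> forall i j, t (i + j) = t i * t j.
Proof.
move=> ft i j.
have fixed0 : (((f 0)`_0)^:P \Po (d1 K + lam1 K)) - ((f 0)`_0)%:P = c%:P%:P * lam1 K.
  by apply: (mulIf f0_neq0); rewrite (rank1_at0 fE) addr0.
have cl0 : c%:P%:P * lam1 K * f 0 != 0 :> {poly {poly K}}.
  by rewrite !mulf_neq0 ?polyX_eq0 // !polyC_eq0.
have := rank1_at0 fE i j; rewrite (ft i) (ft j) (ft (i + j)).
rewrite coefCM !rmorphM /= map_polyC /= comp_polyC => eq_t.
apply/polyC_inj/polyC_inj; apply: (mulIf cl0); rewrite !polyCM.
transitivity (c%:P%:P * lam1 K * ((t (i + j))%:P%:P * f 0)); first by ring.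
by rewrite -eq_t -fixed0; ring.
Qed.

Lemma rank1_powers :
  exists tau rho sigma : K, tau != 0 /\ f =1 trs_poly c tau rho sigma.
Proof.
have [rho [sigma f0E]] := rank1_virasoro.
have [t ft] := boolp.choice rank1_multiple.
have tD := rank1_scalar_morph ft.
have t0 : t 0 = 1.
  apply/polyC_inj/polyC_inj/(mulIf f0_neq0); by rewrite -ft !mul1r.
have tN i : t i * t (- i) = 1 by rewrite -tD subrr.
have t1 : t 1 != 0.
  by apply/eqP => t10; have /eqP := tN 1; rewrite t10 mul0r eq_sym oner_eq0.
have tX (n : nat) : t n%:Z = t 1 ^+ n.
  by elim: n => // n IHn; rewrite -addn1 PoszD tD IHn addn1 exprSr.
exists (t 1), rho, sigma; split=> // i; rewrite ft f0E; congr (_%:P%:P * _).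
case: i => n; first exact: tX.
apply: (mulfI (x := t n.+1)); first by rewrite tX expf_neq0.
by rewrite NegzE tN -exprnN tX divff // expf_neq0.
Qed.
End Virasoro.

End Equation.

(** * Coordinates on a rank one module *)

Section Lconst.
Variables (A : nzRingType) (V : lmodType A).

Lemma coef_lconstZ (P : {poly A}) (v : V) n : (P *: lconst v)@_n = P`_n *: v.
Proof.
rewrite [LHS]coef_lpoly_scale_rev big_ord_recl subn0 big1 => [|i _].
  by rewrite addr0 /lconst mcoeffUU.
by rewrite /lconst mcoeffU /= scaler0.
Qed.

Lemma lconstZ_inj (v : V) : injective (fun a : A => a *: v) ->
  injective (fun P : {poly A} => P *: lconst v).
Proof.
move=> inj_v P Q /= eq_PQ; apply/polyP => n; apply: inj_v.
by rewrite -!coef_lconstZ eq_PQ.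
Qed.

(** If [v] generates [V] over [A], then [v] generates [V[lambda]] over [A[lambda]]:
    this is how a [lambda]-action on [v] becomes a polynomial. *)
Lemma lpoly_gen (v : V) : (forall u, exists a, u = a *: v) ->
  forall g : lpoly V, exists P, g = P *: lconst v.
Proof.
move=> gen; elim/malg_ind => [|g h [P ->] [Q ->]|k u].
- by exists 0; rewrite scale0r.
- by exists (P + Q); rewrite scalerDl.
have [a ->] := gen u; exists (a *: 'X^k); apply/malgP => n.
rewrite coef_lconstZ mcoeffU coefZ coefXn eq_sym.
by case: eqP; rewrite ?mulr1 ?mulr0 ?scale0r.
Qed.

End Lconst.

Section RankOne.
Variables (K : fieldType) (c : K) (M : conformalModule (CW c)).
Variables (phi : {linear M -> {poly K}^o}) (v0 : M).
Hypotheses (phi_v0 : phi v0 = 1) (phi_gen : forall u, u = phi u *: v0).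
Variable f : int -> {poly {poly K}}.
Hypothesis fL : forall i, cm_act (c := M) (CW_L K i) v0 = f i *: lconst v0.

Local Notation act := (@cm_act K (CW c) M).

Let bil : bilinear_lambda act. Proof. by case: (cm_axioms M). Qed.
Let ses : sesquilinear_lambda act. Proof. by case: (cm_axioms M). Qed.

Let phiZ (p : {poly K}) : phi (p *: v0) = p.
Proof. by rewrite linearZ phi_v0; apply: mulr1. Qed.

Lemma v0_free : injective (fun p : {poly K} => p *: v0).
Proof. by move=> p q /(congr1 phi); rewrite !phiZ. Qed.

Lemma act_coord p i q :
  act << p *g i >> (q *: v0) = (sesq p q * f i) *: lconst v0.
Proof.
have -> : << p *g i >> = p *: CW_L K i by rewrite /CW_L CWZU mulr1.
by rewrite (actZl bil ses) (actZr bil ses) fL !scalerA.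
Qed.

Lemma act_rank1_equation : rank1_equation c f.
Proof.
apply: rank1_equation_generic => i j e2.
have [_ _ jac] := cm_axioms M.
have br_ij := CW_bracketL c i j.
have := jac (CW_L K i) (CW_L K j) v0.
rewrite (act_actE bil ses _ _ (fL j) (fL i)) (act_actE bil ses _ _ (fL i) (fL j)).
rewrite (bracket_actE bil ses br_ij (fL (i + j))) -scalerBl.
move/(lconstZ_inj (lconstZ_inj v0_free)) => ->.
rewrite ev2_vir; congr (_ * _ * _); ring.
Qed.

Lemma act_neq0 : nontrivial M -> exists i, f i != 0.
Proof.
case=> x [v]; elim/malg_ind: x => [|x y IHx IHy|i p].
- by rewrite (morph0D (actDl bil v)).
- rewrite (actDl bil) => xy_neq0.
  have [x0|/eqP/IHx//] := eqVneq (act x v) 0.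
  by apply: IHy => y0; apply: xy_neq0; rewrite x0 y0 addr0.
rewrite (phi_gen v) act_coord => neq0; exists i; apply/eqP => fi0.
by apply: neq0; rewrite fi0 mulr0 scale0r.
Qed.

Lemma isomorphic_rank1 fP : isomorphic M (rank1_module (f := f) fP).
Proof.
exists phi; split.
  exists (fun q : {poly K} => q *: v0) => [u|q]; first by rewrite -phi_gen.
  exact: phiZ.
have [bilN _] := rank1_sesq f.
move=> x v n; rewrite /=.
elim/malg_ind: x => [|x y IHx IHy|i p].
- by rewrite (morph0D (actDl bilN _)) (morph0D (actDl bil v)) !mcoeff0 linear0.
- by rewrite (actDl bilN) (actDl bil) !mcoeffD IHx IHy linearD.
rewrite rank1_actU coef_lconstZ [in RHS](phi_gen v) act_coord coef_lconstZ.
by rewrite linearZ phi_v0.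
Qed.

(** [p M] is a submodule, since the action of [R] on [q p v] is a multiple of [f_i v];
    irreducibility leaves [p M = M], so [p] is invertible. *)
Lemma irreducible_divisor (p : {poly K}) : irreducible M ->
  p != 0 -> (forall i, exists k, f i = k * p%:P) -> (size p <= 1)%N.
Proof.
move=> [_ irr] p0 dvd_f.
pose W (u : M) := exists q, u = (q * p) *: v0.
have WD u v : W u -> W v -> W (u + v).
  by move=> [q ->] [r ->]; exists (q + r); rewrite mulrDl scalerDl.
have W0 : W 0 by exists 0; rewrite mul0r scale0r.
have subW : submodule W.
  split=> // [r u v [q ->] Wv|x v n [q ->]].
    by apply: WD => //; exists (r * q); rewrite scalerA mulrA.
  elim/malg_ind: x => [|x y IHx IHy|i r].
  - by rewrite (morph0D (actDl bil _)) mcoeff0.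
  - by rewrite (actDl bil) mcoeffD; apply: WD.
  have [k fk] := dvd_f i.
  by rewrite act_coord fk mulrA coef_lconstZ coefMC; eexists.
case: (irr W subW) => [W_0|W_all].
  have : p *: v0 = 0 :> M by apply/W_0; exists 1; rewrite mul1r.
  by rewrite -(scale0r v0) => /v0_free p_0; rewrite p_0 eqxx in p0.
have [q] := W_all v0; rewrite -[LHS]scale1r => /v0_free eq1.
have : p %| 1 by rewrite eq1 dvdp_mulIr.
by rewrite dvdp1 => /eqP->.
Qed.

End RankOne.

Lemma rank1_coord (K : fieldType) (R : lieConformalAlgebra K) (M : conformalModule R) :
  has_rank M 1 -> exists (phi : {linear M -> {poly K}^o}) (v0 : M),
    phi v0 = 1 /\ forall u, u = phi u *: v0.
Proof.
case=> f [g fK gK].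
pose phi (u : M) : {poly K}^o := f u 0 0.
have phi_lin : linear phi by move=> a u v; rewrite /phi linearP !mxE.
pose phiL : {linear M -> {poly K}^o} :=
  HB.pack phi (GRing.isLinear.Build _ _ _ _ phi phi_lin).
exists phiL, (g 1%:M); split=> [|u]; first by rewrite /= /phi gK mxE.
apply: (can_inj fK); rewrite linearZ gK /=; apply/matrixP => i j.
by rewrite !ord1 !mxE eqxx mulr1.
Qed.

(** * The classification *)

Theorem corollary4p2 (R : realType) (c : R[i]) (M : conformalModule (CW c))
    (M_nontrivial : nontrivial M) (M_irr : irreducible M)
    (M_rank1 : has_rank M 1) :
  (forall c_eq0 : c = 0,
     exists h : int -> {poly R[i]},
       (exists i, h i != 0) /\ isomorphic M (mod_h c_eq0 h)) /\
  (c != 0 ->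
     exists (tau : R[i]) (tau_neq0 : tau != 0) (rho sigma : R[i]),
       rho != 0 /\ isomorphic M (mod_trs c tau_neq0 rho sigma)).
Proof.
have charC : [pchar R[i]] =i pred0 by exact: Num.Theory.pchar_num.
have [phi [v0 [phi_v0 phi_gen]]] := rank1_coord M_rank1.
have genM u : exists p : {poly R[i]}, u = p *: v0 by exists (phi u).
have [f fL] := boolp.choice (fun i => lpoly_gen genM (cm_act (c := M) (CW_L _ i) v0)).
have fE := act_rank1_equation phi_v0 fL.
have [i0 f_neq0] := act_neq0 phi_gen fL M_nontrivial.
split=> [c0|c0].
  pose h i := (swapXY (f i))`_0.
  have fh : f =1 fun i => (h i)^:P.
    by move=> i; apply: (rank1_abelian charC); rewrite -c0.
  exists h; split.
    by exists i0; apply: contraNneq f_neq0 => h0; rewrite fh h0 rmorph0.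
  by apply: (isomorphic_rank1 phi_v0 phi_gen) => i; rewrite fL fh.
have f0_neq0 : f 0 != 0.
  apply: contraNneq f_neq0 => f00.
  by apply/eqP; apply: (rank1_degenerate c0 fE f00).
have [tau [rho [sigma [tau0 fT]]]] := rank1_powers charC c0 fE f0_neq0.
exists tau, tau0, rho, sigma; split; last first.
  by apply: (isomorphic_rank1 phi_v0 phi_gen) => i; rewrite fL fT.
(* If rho = 0 then every f_i is a scalar multiple of c d + sigma. *)
apply/eqP => rho0; pose p : {poly R[i]} := c *: 'X + sigma%:P.
have szp : size p = 2.
  by rewrite /p size_polyDl size_scale ?size_polyX // size_polyC; case: eqP.
have p0 : p != 0 by rewrite -size_poly_eq0 szp.
have := irreducible_divisor phi_v0 fL M_irr p0; rewrite szp => /(_ _) H.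
suff /H: forall i, exists k, f i = k * p%:P by [].
move=> i; exists (tau ^ i)%:P%:P; rewrite fT /trs_poly rho0 mul0r addr0.
by rewrite /p -mul_polyC polyCD polyCM.
Qed.
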